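(* Let $d=2$ (matrix completion), let $n_1,n_2$ be positive integers, $\Omega\subseteq\mathcal{G}=[n_1]\times[n_2]$, and let $\hat T\in\mathbb{R}^\Omega$ have all entries nonzero. Then the relaxation (SDP-E) is tight if and only if the exact rank-one completion problem for $(\Omega,\hat T)$ has a unique solution.
   Context: Notation: $[m]=\{1,\dots,m\}$; $N=n_1n_2$; coordinates of $\mathbb{R}^N$ are indexed by $\mathcal{G}=[n_1]\times[n_2]$, and $\mathbb{S}^N$ is the space of real symmetric $N\times N$ matrices (rows and columns indexed by $\mathcal{G}$). Exact rank-one completion problem for $(\Omega,\hat T)$: find a rank-one matrix $T\in\mathbb{R}^{n_1\times n_2}$ with $T_\alpha=\hat T_\alpha$ for all $\alpha\in\Omega$. Square: $\{\alpha_1,\alpha_2;\alpha_3,\alpha_4\}$ is a square if $\alpha_1,\dots,\alpha_4\in\mathcal{G}$ are distinct and for $k\in\{1,2\}$, $\max\{(\alpha_1)_k,(\alpha_2)_k\}=\max\{(\alpha_3)_k,(\alpha_4)_k\}$ and $\min\{(\alpha_1)_k,(\alpha_2)_k\}=\min\{(\alpha_3)_k,(\alpha_4)_k\}$. Let $\mathcal{A}$ be the set of all squares. (SDP-E): minimize $\operatorname{tr}(X)$ over $x\in\mathbb{R}^N$, $X\in\mathbb{S}^N$ subject to $x_\alpha=\hat T_\alpha$ and $X_{\alpha,\alpha}=\hat T_\alpha^2$ for all $\alpha\in\Omega$; $X_{\alpha_1,\alpha_2}=X_{\alpha_3,\alpha_4}$ for all $\{\alpha_1,\alpha_2;\alpha_3,\alpha_4\}\in\mathcal{A}$;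 and $\mathbf{X}:=\begin{pmatrix}1 & x^T \\ x & X\end{pmatrix}\succeq0$. Tight: (SDP-E) is tight if the completion problem has a unique solution $T$ and, with $\bar x\in\mathbb{R}^N$, $\bar x_\beta=T_\beta$, (SDP-E) has a unique optimal solution, namely the rank-one matrix $\bar{\mathbf{X}}=\begin{pmatrix}1 & \bar x^T \\ \bar x & \bar x\bar x^T\end{pmatrix}$. *)

(* Defs.v *)
From mathcomp Require Export all_boot all_order all_algebra.
From mathcomp Require Export reals.

Set Implicit Arguments.
Unset Strict Implicit.
Unset Printing Implicit Defensive.

Import Order.TTheory GRing.Theory Num.Theory.

Local Open Scope ring_scope.

(* [n1] x [n2], with each [m] = {1, .., m} shifted down to {0, .., m.-1}. *)
Notation grid n1 n2 := ('I_n1 * 'I_n2)%type.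

(* R^N with N = n1 * n2 is 'cV_(n1 * n2), indexed by the grid through the
   library bijection mxvec_index : [n1] x [n2] -> 'I_(n1 * n2), for which
   mxvec T 0 (gidx a) = T a.1 a.2 (mxvecE). *)
Definition gidx n1 n2 (a : grid n1 n2) : 'I_(n1 * n2) := mxvec_index a.1 a.2.

(* The data That is a family indexed by the subtype of the elements of Omega,
   so that it has no values off Omega. *)
Definition rank1_completion (R : realType) n1 n2 (Omega : {set grid n1 n2})
    (That : {a : grid n1 n2 | a \in Omega} -> R) (T : 'M[R]_(n1, n2)) : Prop :=
  \rank T = 1%N /\
  forall a : {a : grid n1 n2 | a \in Omega}, T (val a).1 (val a).2 = That a.

Definition is_square n1 n2 (a1 a2 a3 a4 : grid n1 n2) : Prop :=
  [/\ uniq [:: a1; a2; a3; a4],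
      maxn a1.1 a2.1 = maxn a3.1 a4.1 /\ minn a1.1 a2.1 = minn a3.1 a4.1
    & maxn a1.2 a2.2 = maxn a3.2 a4.2 /\ minn a1.2 a2.2 = minn a3.2 a4.2].

Definition psdmx (R : realType) n (A : 'M[R]_n) : Prop :=
  A \is symmetricmx /\ forall v : 'cV[R]_n, 0 <= (v^T *m A *m v) 0 0.

Definition lift_mx (R : realType) N (x : 'cV[R]_N) (X : 'M[R]_N) :
    'M[R]_(1 + N) :=
  block_mx 1%:M x^T x X.

Definition sdpE_feasible (R : realType) n1 n2 (Omega : {set grid n1 n2})
    (That : {a : grid n1 n2 | a \in Omega} -> R)
    (x : 'cV[R]_(n1 * n2)) (X : 'M[R]_(n1 * n2)) : Prop :=
  [/\ X \is symmetricmx,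
      forall a : {a : grid n1 n2 | a \in Omega},
        x (gidx (val a)) 0 = That a /\
        X (gidx (val a)) (gidx (val a)) = That a ^+ 2,
      forall a1 a2 a3 a4 : grid n1 n2, is_square a1 a2 a3 a4 ->
        X (gidx a1) (gidx a2) = X (gidx a3) (gidx a4)
    & psdmx (lift_mx x X)].

Definition sdpE_optimal (R : realType) n1 n2 (Omega : {set grid n1 n2})
    (That : {a : grid n1 n2 | a \in Omega} -> R)
    (x : 'cV[R]_(n1 * n2)) (X : 'M[R]_(n1 * n2)) : Prop :=
  sdpE_feasible That x X /\
  forall (y : 'cV[R]_(n1 * n2)) (Y : 'M[R]_(n1 * n2)),
    sdpE_feasible That y Y -> \tr X <= \tr Y.

Definition sdpE_tight (R : realType) n1 n2 (Omega : {set grid n1 n2})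
    (That : {a : grid n1 n2 | a \in Omega} -> R) : Prop :=
  exists T : 'M[R]_(n1, n2),
    unique (rank1_completion That) T /\
    let xbar : 'cV[R]_(n1 * n2) := (mxvec T)^T in
    sdpE_optimal That xbar (xbar *m xbar^T) /\
    forall (x : 'cV[R]_(n1 * n2)) (X : 'M[R]_(n1 * n2)),
      sdpE_optimal That x X -> lift_mx x X = lift_mx xbar (xbar *m xbar^T).

(* Main.v *)
Require Import Defs.
From mathcomp Require Import ring lra.
Set Implicit Arguments.
Unset Strict Implicit.
Unset Printing Implicit Defensive.

Import Order.TTheory GRing.Theory Num.Theory.

Local Open Scope ring_scope.

(** Why uniqueness of the completion forces tightness (the converse is part of
    the definition of tightness).

    Write the unique completion as T i j = u i * v j.  Varying u and v inside
    the set of completions shows two things.  A row or a column without an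
    observed entry could be modified freely, so every row and every column
    meets Omega and T has no zero entry (completion_neq0).  If A is a set of
    rows and B a set of columns such that every observed entry lies in A x B or
    in the complement of A times the complement of B, then doubling u on A and
    halving v on B gives another completion; hence A and B are both empty or
    both full (completion_no_cut).  This is connectedness of the bipartite
    graph of Omega, in the form in which it is used.

    Now let (x, X) be feasible.  The Schur complement X - x x^T is positive
    semidefinite and its diagonal vanishes on Omega, so its rows indexed by
    Omega vanish: X a b = T a * x b for a in Omega and every b.  If two rows i
    and k are both observed in column j, the square
    {(i,j), (k,l); (i,l), (k,j)} then gives T i j * x (k,l) = T k j * x (i,l),
    that is, the ratio x (i,l) / T i l does not change from row i to row k.
    The rows where this ratio is 1 form one side of a cut as above, and they
    include a row observed in column l, so all rows belong to it: x = T
    (feasible_vec_unique).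

    All feasible points thus have the same x, and
    tr X - tr (x x^T) = tr (X - x x^T) >= 0, with equality only if the positive
    semidefinite matrix X - x x^T is 0.  The rank-one lift of T, which is
    feasible because T is a product u i * v j, is therefore the only
    minimizer. *)

(** * Positive semidefinite matrices *)

Lemma symmetricmxE (R : fieldType) n (A : 'M[R]_n) :
  (A \is symmetricmx) = (A^T == A).
Proof. by rewrite is_hermitianmxE expr0 scale1r map_mx_id // eq_sym. Qed.

Section PositiveSemidefinite.

Variables (R : realType) (n : nat).
Implicit Types (A X : 'M[R]_n) (x w : 'cV[R]_n).

Lemma bilinear_delta A (a b : 'I_n) :
  ((delta_mx a 0 : 'cV[R]_n)^T *m A *m (delta_mx b 0 : 'cV[R]_n)) 0 0 = A a b.
Proof. by rewrite trmx_delta -rowE -colE !mxE. Qed.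

Lemma psdmx_outer p (c : 'cV[R]_p) : psdmx (c *m c^T).
Proof.
split=> [|w]; first by rewrite symmetricmxE trmx_mul trmxK.
have -> : w^T *m (c *m c^T) *m w = (w^T *m c) *m (w^T *m c)^T.
  by rewrite trmx_mul trmxK !mulmxA.
by rewrite mxE big_ord1 [(_ ^T) _ _]mxE -expr2 sqr_ge0.
Qed.

Lemma psdmx_diag_ge0 A (a : 'I_n) : psdmx A -> 0 <= A a a.
Proof. by case=> _ /(_ (delta_mx a 0)); rewrite bilinear_delta. Qed.

(** On the line t e_a + e_b the form is 2 t A a b + A b b, which is affine in t
    and can stay nonnegative only with slope 0. *)
Lemma psdmx_diag_eq0 A (a b : 'I_n) : psdmx A -> A a a = 0 -> A a b = 0.
Proof.
move=> [symA posA] Aaa; apply/eqP; apply: contraT => Aab.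
have Aba : A b a = A a b.
  by move: symA; rewrite symmetricmxE => /eqP/matrixP/(_ a b); rewrite mxE.
(* At this t the form takes the value -1. *)
have := posA (- (A b b + 1) / (2 * A a b) *: delta_mx a 0 + delta_mx b 0).
set t := _ / _; rewrite [(_ + _)^T]linearD /=.
rewrite [(_ *: _)^T]linearZ /= !mulmxDl !mulmxDr -!scalemxAl.
rewrite -!scalemxAr.
have entry (B C : 'M[R]_1) : (B + C) 0 0 = B 0 0 + C 0 0 by rewrite mxE.
have entryZ k (B : 'M[R]_1) : (k *: B) 0 0 = k * B 0 0 by rewrite mxE.
rewrite !(entry, entryZ) !bilinear_delta Aaa Aba !mulr0 add0r.
have -> : t * A a b = - (A b b + 1) / 2 by rewrite /t; field.
by lra.
Qed.

Lemma psdmx_trace_ge0 A : psdmx A -> 0 <= \tr A.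
Proof. by move=> psdA; apply: sumr_ge0 => a _; apply: psdmx_diag_ge0. Qed.

Lemma psdmx_trace_eq0 A : psdmx A -> \tr A = 0 -> A = 0.
Proof.
move=> psdA trA; apply/matrixP=> a b; rewrite mxE.
have diag0 := psumr_eq0P (fun d _ => psdmx_diag_ge0 d psdA) trA.
exact: psdmx_diag_eq0 psdA (diag0 a isT).
Qed.

(** The form of the lifted matrix at (- x^T w, w) is the form of the Schur
    complement at w. *)
Lemma psdmx_lift_schur x X : psdmx (lift_mx x X) -> psdmx (X - x *m x^T).
Proof.
move=> [symL posL]; split.
  move: symL; rewrite !symmetricmxE /lift_mx tr_block_mx => /eqP/eq_block_mx.
  by case=> _ _ _ symX; rewrite linearB /= symX trmx_mul trmxK.
move=> w; have := posL (col_mx (- (x^T *m w)) w).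
rewrite tr_col_mx linearN /= trmx_mul trmxK /lift_mx mul_row_block mul_row_col.
by rewrite mulmx1 addNr mul0mx add0r mulNmx addrC mulmxBr mulmxA.
Qed.

Lemma psdmx_lift_outer x : psdmx (lift_mx x (x *m x^T)).
Proof.
have -> : lift_mx x (x *m x^T) = col_mx 1%:M x *m (col_mx 1%:M x)^T.
  by rewrite tr_col_mx mul_col_row trmx1 !mul1mx mulmx1.
exact: psdmx_outer.
Qed.

End PositiveSemidefinite.

(** * Rank-one matrices and unique completions *)

(** A square consists of the same two rows and the same two columns on either
    side, and a product u i * v j only sees these. *)
Lemma maxn_minn_mul (S : comNzRingType) m (f : 'I_m -> S) (i k i' k' : 'I_m) :
  maxn i k = maxn i' k' -> minn i k = minn i' k' -> f i * f k = f i' * f k'.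
Proof.
case: (leqP i k) => _; case: (leqP i' k') => _ /val_inj -> /val_inj -> //;
  exact: mulrC.
Qed.

Section RankOne.

Variables (F : fieldType) (m n : nat).

Lemma rank1_factors (T : 'M[F]_(m, n)) : \rank T = 1%N ->
  exists (u : 'I_m -> F) (v : 'I_n -> F), forall i j, T i j = u i * v j.
Proof.
move=> rT; have := mulmx_base T; move: (col_base T) (row_base T).
rewrite rT => c r <-; exists (c^~ 0), (r 0) => i j.
by rewrite mxE big_ord1.
Qed.

Lemma rank_outer (u : 'I_m -> F) (v : 'I_n -> F) i j :
  u i != 0 -> v j != 0 -> \rank (\matrix_(k, l) (u k * v l)) = 1%N.
Proof.
move=> ui vj; apply/eqP; rewrite eqn_leq; apply/andP; split.
  have -> : \matrix_(k, l) (u k * v l) = (\col_k u k) *m (\row_l v l).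
    by apply/matrixP=> k l; rewrite !mxE big_ord1 !mxE.
  exact: leq_trans (mxrankM_maxl _ _) (rank_leq_col _).
rewrite lt0n mxrank_eq0; apply: contraNneq (mulf_neq0 ui vj) => /matrixP.
by move/(_ i j); rewrite !mxE => ->.
Qed.

End RankOne.

Section UniqueCompletion.

Variables (R : realType) (n1 n2 : nat) (Omega : {set grid n1 n2}).
Variable That : {a : grid n1 n2 | a \in Omega} -> R.
Hypothesis That_neq0 : forall a, That a != 0.
Variable T : 'M[R]_(n1, n2).
Hypothesis T_completion : rank1_completion That T.
Hypothesis T_unique : forall T', rank1_completion That T' -> T = T'.

Lemma completionE i j (ij : (i, j) \in Omega) : T i j = That (exist _ (i, j) ij).
Proof. by case: T_completion => _ /(_ (exist _ (i, j) ij)). Qed.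

Lemma completion_obs_neq0 i j : (i, j) \in Omega -> T i j != 0.
Proof. by move=> ij; rewrite (completionE ij). Qed.

Lemma completion_factors_unique (u : 'I_n1 -> R) (v : 'I_n2 -> R) i j :
    u i != 0 -> v j != 0 ->
    (forall k l, (k, l) \in Omega -> u k * v l = T k l) ->
  forall k l, T k l = u k * v l.
Proof.
move=> ui vj obs k l.
suff -> : T = \matrix_(k, l) (u k * v l) by rewrite mxE.
apply: T_unique; split; first exact: rank_outer ui vj.
by case=> -[p q] pq; rewrite mxE obs // (completionE pq).
Qed.

Variables (u : 'I_n1 -> R) (v : 'I_n2 -> R).
Hypothesis T_factors : forall i j, T i j = u i * v j.

Let factors_neq0 : exists i j, u i != 0 /\ v j != 0.
Proof.
have [rT _] := T_completion.
have : T != 0 by rewrite -mxrank_eq0 rT.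
case/matrix0Pn => i [j]; rewrite T_factors mulf_eq0 negb_or => /andP[ui vj].
by exists i, j.
Qed.

(** If row i carried no observation, its factor could be both 1 and 2. *)
Lemma row_observed i : exists j, (i, j) \in Omega.
Proof.
have [_ [j [_ vj]]] := factors_neq0.
case: (pickP [pred l | (i, l) \in Omega]) => [l il|no]; first by exists l.
have free c : c != 0 -> T i j = c * v j.
  pose u' k := if k == i then c else u k.
  have u'i : u' i = c by rewrite /u' eqxx.
  rewrite -u'i => c0; apply: (completion_factors_unique c0 vj) => k l kl.
  by rewrite T_factors /u'; case: eqP kl (no l) => // -> /= ->.
have := free 1 (oner_neq0 _); rewrite (free 2) ?pnatr_eq0 // => /(mulIf vj)/eqP.
by rewrite pnatr_eq1.
Qed.

Lemma col_observed j : exists i, (i, j) \in Omega.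
Proof.
have [i [_ [ui _]]] := factors_neq0.
case: (pickP [pred k | (k, j) \in Omega]) => [k kj|no]; first by exists k.
have free c : c != 0 -> T i j = u i * c.
  pose v' l := if l == j then c else v l.
  have v'j : v' j = c by rewrite /v' eqxx.
  rewrite -v'j => c0; apply: (completion_factors_unique ui c0) => k l kl.
  by rewrite T_factors /v'; case: eqP kl (no k) => // -> /= ->.
have := free 1 (oner_neq0 _); rewrite (free 2) ?pnatr_eq0 // => /(mulfI ui)/eqP.
by rewrite pnatr_eq1.
Qed.

Lemma completion_neq0 i j : T i j != 0.
Proof.
have [l /completion_obs_neq0] := row_observed i.
have [k /completion_obs_neq0] := col_observed j.
rewrite !T_factors !mulf_eq0 !negb_or => /andP[_ vj] /andP[ui _].
by rewrite ui.
Qed.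

(** Doubling u on A and halving v on B does not change the observed entries. *)
Lemma completion_no_cut (A : {set 'I_n1}) (B : {set 'I_n2}) :
    (forall i j, (i, j) \in Omega -> (i \in A) = (j \in B)) ->
  forall i j, (i \in A) = (j \in B).
Proof.
move=> cut i j.
pose s (b : bool) : R := if b then 2 else 1.
have s0 b : s b != 0 by case: b; rewrite /s ?pnatr_eq0 ?oner_eq0.
have := completion_neq0 i j; rewrite T_factors mulf_eq0 negb_or => /andP[ui vj].
have ui' : s (i \in A) * u i != 0 by rewrite mulf_neq0.
have vj' : (s (j \in B))^-1 * v j != 0 by rewrite mulf_neq0 ?invr_eq0.
have prodE k l : s (k \in A) * u k * ((s (l \in B))^-1 * v l)
    = s (k \in A) / s (l \in B) * T k l by rewrite T_factors mulrACA.
have /(_ _ i j) := @completion_factors_unique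
  (fun k => s (k \in A) * u k) (fun l => (s (l \in B))^-1 * v l) i j ui' vj'.
rewrite prodE -[X in X = _]mul1r => TE.
have {TE} /(mulIf (completion_neq0 i j)) :
    1 * T i j = s (i \in A) / s (j \in B) * T i j.
  by apply: TE => k l kl; rewrite prodE (cut _ _ kl) divff // mul1r.
move/(congr1 ( *%R^~ (s (j \in B)))); rewrite divfK // mul1r /s.
by case: (i \in A) (j \in B) => -[] // /eqP; rewrite 1?[1 == _]eq_sym pnatr_eq1.
Qed.

(** * Feasible points of the relaxation *)

Section Feasible.

Variables (x : 'cV[R]_(n1 * n2)) (X : 'M[R]_(n1 * n2)).
Hypothesis feasX : sdpE_feasible That x X.

Lemma feasible_schur_psd : psdmx (X - x *m x^T).
Proof. by case: feasX => _ _ _ /psdmx_lift_schur. Qed.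

Lemma feasible_obs_vec i j : (i, j) \in Omega -> x (gidx (i, j)) 0 = T i j.
Proof.
move=> ij; rewrite (completionE ij).
by case: feasX => _ /(_ (exist _ (i, j) ij)) [].
Qed.

Lemma feasible_obs_row i j b :
  (i, j) \in Omega -> X (gidx (i, j)) b = T i j * x b 0.
Proof.
move=> ij; set a := gidx (i, j).
have schurE c d : (X - x *m x^T) c d = X c d - x c 0 * x d 0.
  by rewrite !mxE big_ord1 mxE.
have diag0 : (X - x *m x^T) a a = 0.
  rewrite schurE -expr2 (feasible_obs_vec ij) (completionE ij).
  by case: feasX => _ /(_ (exist _ (i, j) ij)) [_ ->] _ _; rewrite subrr.
have /eqP := psdmx_diag_eq0 b feasible_schur_psd diag0.
by rewrite schurE subr_eq0 (feasible_obs_vec ij) => /eqP.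
Qed.

Lemma feasible_obs_column i k j l : (i, j) \in Omega -> (k, j) \in Omega ->
  T i j * x (gidx (k, l)) 0 = T k j * x (gidx (i, l)) 0.
Proof.
move=> ij kj.
(* A square needs distinct rows and columns; the degenerate cases hold as the
   entries of x in column j are observed. *)
have [->|ik] := eqVneq i k; first by [].
have [<-|jl] := eqVneq j l.
  by rewrite (feasible_obs_vec ij) (feasible_obs_vec kj) mulrC.
have sq : is_square (i, j) (k, l) (i, l) (k, j).
  split=> /=; last by rewrite maxnC minnC.
    rewrite !inE !xpair_eqE !eqxx (negPf ik) (negPf jl) !(eq_sym k) (eq_sym l).
    by rewrite (negPf ik) (negPf jl).
  by [].
case: feasX => symX _ /(_ _ _ _ _ sq) + _.
rewrite (feasible_obs_row _ ij).
have -> : X (gidx (i, l)) (gidx (k, j)) = X (gidx (k, j)) (gidx (i, l)).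
  move: symX; rewrite symmetricmxE => /eqP/matrixP.
  by move/(_ (gidx (k, j)) (gidx (i, l))); rewrite mxE.
by rewrite (feasible_obs_row _ kj).
Qed.

(** For a fixed column l, the rows where x agrees with T, together with the
    columns observed in such a row, form a side of a cut. *)
Lemma feasible_vec_entry i l : x (gidx (i, l)) 0 = T i l.
Proof.
pose A := [set k | x (gidx (k, l)) 0 == T k l].
pose B := [set j | [exists k in A, (k, j) \in Omega]].
have A_closed k k' j : (k, j) \in Omega -> (k', j) \in Omega ->
    k \in A -> k' \in A.
  move=> kj k'j; rewrite !inE => /eqP xk; have := feasible_obs_column l kj k'j.
  rewrite xk => xk'; apply/eqP; apply: (mulfI (completion_obs_neq0 kj)).
  by rewrite xk' !T_factors; ring.
have cut k j : (k, j) \in Omega -> (k \in A) = (j \in B).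
  move=> kj; apply/idP/idP => [kA|].
    by rewrite inE; apply/existsP; exists k; rewrite kA.
  by rewrite inE => /existsP[k' /andP[k'A k'j]]; exact: A_closed k'j kj k'A.
have [k kl] := col_observed l.
have kA : k \in A by rewrite inE (feasible_obs_vec kl).
have := completion_no_cut cut i l; rewrite -(completion_no_cut cut k l) kA.
by rewrite inE => /eqP.
Qed.

Lemma feasible_vec_unique : x = (mxvec T)^T.
Proof.
apply/colP=> a; case/mxvec_indexP: a => i j.
by rewrite -[mxvec_index i j]/(gidx (i, j)) feasible_vec_entry mxE mxvecE.
Qed.

End Feasible.

Lemma outer_feasible :
  let x := (mxvec T)^T in sdpE_feasible That x (x *m x^T).
Proof.
move=> x.
have xE a : x (gidx a) 0 = T a.1 a.2 by rewrite mxE mxvecE.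
have XE a b : (x *m x^T) (gidx a) (gidx b) = T a.1 a.2 * T b.1 b.2.
  by rewrite mxE big_ord1 [x^T _ _]mxE !xE.
have [_ obs] := T_completion; split.
- by have [] := psdmx_outer x.
- by move=> a; rewrite xE XE obs.
- move=> a1 a2 a3 a4 [_ [max1 min1] [max2 min2]].
  rewrite !XE !T_factors mulrACA [RHS]mulrACA.
  by rewrite (maxn_minn_mul u max1 min1) (maxn_minn_mul v max2 min2).
- exact: psdmx_lift_outer.
Qed.

(** Feasible points share the vector x, so their traces differ by the trace of
    the positive semidefinite Schur complement. *)
Lemma feasible_trace x X (xbar := (mxvec T)^T) : sdpE_feasible That x X ->
  \tr (xbar *m xbar^T) <= \tr X
  /\ (\tr X <= \tr (xbar *m xbar^T) -> x = xbar /\ X = xbar *m xbar^T).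
Proof.
move=> feasX; have xE : x = xbar := feasible_vec_unique feasX.
have := feasible_schur_psd feasX; rewrite xE => psdS.
have := psdmx_trace_ge0 psdS; rewrite linearB /= subr_ge0 => le_tr.
split=> // ge_tr; split=> //; apply/eqP; rewrite -subr_eq0; apply/eqP.
apply: psdmx_trace_eq0 psdS _; rewrite linearB /=.
by apply/eqP; rewrite subr_eq0 eq_le ge_tr.
Qed.

End UniqueCompletion.

Theorem corollary1 (R : realType) (n1 n2 : nat) (hn1 : (0 < n1)%N)
    (hn2 : (0 < n2)%N) (Omega : {set 'I_n1 * 'I_n2})
    (That : {a : 'I_n1 * 'I_n2 | a \in Omega} -> R)
    (That_neq0 : forall a, That a != 0) :
  sdpE_tight That <->
  exists! T : 'M[R]_(n1, n2), rank1_completion That T.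
Proof.
split=> [[T [uT _]]|[T uT]]; first by exists T.
exists T; split=> // xbar; have [cT T_unique] := uT.
have [u [v T_factors]] := rank1_factors (proj1 cT).
have feas := outer_feasible cT T_factors.
have traces := feasible_trace That_neq0 cT T_unique T_factors.
split=> [|x X [feasX optX]]; first by split=> // y Y /traces[].
by have [_ /(_ (optX _ _ feas)) [-> ->]] := traces _ _ feasX.
Qed.
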